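(* Let $m\geq 1$ and let $\mathcal{S}\subseteq[m]\times[m]\times[m]$. Then: (i) if $\mathcal{S}$ is tight then $|\mathcal{S}|\leq\lceil\frac34 m^2\rceil$, and the inequality is sharp (for every $m$ there is a tight $\mathcal{S}$ attaining equality); (ii) if $\mathcal{S}$ is oblique then $|\mathcal{S}|\leq\lceil\frac34 m^2\rceil$, and the inequality is sharp (for every $m$ there is an oblique $\mathcal{S}$ attaining equality); (iii) if $\mathcal{S}$ is free then $|\mathcal{S}|\leq m^2$, and the inequality is sharp (for every $m$ there is a free $\mathcal{S}$ attaining equality).
   Context: Write $[m]=\{1,\dots,m\}$. A subset $\mathcal{S}\subseteq[m]\times[m]\times[m]$ is concise if its three projections to $[m]$ are surjective. A concise subset $\mathcal{S}$ is called: - tight if there exist injective functions $\tau_A,\tau_B,\tau_C:[m]\to\mathbb{Z}$ such that $\tau_A(i)+\tau_B(j)+\tau_C(k)=0$ for every $(i,j,k)\in\mathcal{S}$; - oblique if there are total orders on the three copies of $[m]$ such that no two distinct elements of $\mathcal{S}$ are comparable in the induced product partial order on $[m]\times[m]\times[m]$ (i.e. $\mathcal{S}$ is an antichain); - free if any two distinct elements of $\mathcal{S}$ differ in at least two of their three entries. *)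

(* Defs.v *)
From mathcomp Require Import all_boot all_order all_algebra.

Set Implicit Arguments.
Unset Strict Implicit.
Unset Printing Implicit Defensive.

Import Order.TTheory GRing.Theory Num.Theory.

(* The index set [m] = {1, ..., m} is encoded as 'I_m = {0, ..., m - 1}; no
   notion below depends on the labels.  A triple (i, j, k) is the left-nested
   pair ((i, j), k), with components x.1.1, x.1.2 and x.2. *)

Definition triple (m : nat) : finType := ('I_m * 'I_m * 'I_m)%type.

Definition concise (m : nat) (S : {set triple m}) : Prop :=
  [/\ forall i : 'I_m, exists2 x, x \in S & x.1.1 = i,
      forall j : 'I_m, exists2 x, x \in S & x.1.2 = j
    & forall k : 'I_m, exists2 x, x \in S & x.2 = k].

(* Tightness, obliqueness and freeness are notions for concise sets, so each
   of them includes conciseness. *)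

Definition is_tight (m : nat) (S : {set triple m}) : Prop :=
  concise S /\
  exists tauA tauB tauC : 'I_m -> int,
    [/\ injective tauA, injective tauB, injective tauC
      & forall i j k : 'I_m, (i, j, k) \in S ->
          (tauA i + tauB j + tauC k = 0)%R].

(* Reflexivity follows from totality. *)
Definition total_order (T : Type) (le : rel T) : Prop :=
  [/\ @antisymmetric T le, transitive le & total le].

Definition product_le (m : nat) (leA leB leC : rel 'I_m) : rel (triple m) :=
  fun x y => [&& leA x.1.1 y.1.1, leB x.1.2 y.1.2 & leC x.2 y.2].

Definition antichain (T : finType) (le : rel T) (S : {set T}) : Prop :=
  forall x y : T, x \in S -> y \in S -> x != y -> ~~ (le x y || le y x).

Definition is_oblique (m : nat) (S : {set triple m}) : Prop :=
  concise S /\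
  exists leA leB leC : rel 'I_m,
    [/\ total_order leA, total_order leB, total_order leC
      & antichain (product_le leA leB leC) S].

(* The sum counts, through the coercion of bool to nat, the entries in which
   x and y differ. *)
Definition differing_entries (m : nat) (x y : triple m) : nat :=
  (x.1.1 != y.1.1) + (x.1.2 != y.1.2) + (x.2 != y.2).

Definition is_free (m : nat) (S : {set triple m}) : Prop :=
  concise S /\
  forall x y : triple m, x \in S -> y \in S -> x != y ->
    2 <= differing_entries x y.

Definition ceil_three_quarters_sq (m : nat) : int :=
  Num.ceil (3 / 4 * m%:R ^+ 2 : rat)%R.

(* Main.v *)
(** Tight sets are antichains for the orders pulled back along the tau's, so
    (i) and (ii) need one upper bound and one extremal set.  The rank levels
    [i + j + k = s] are tight, and the middle one attains the bound.  For the
    upper bound, the grid of pairs (i, j) is partitioned into m symmetric hooks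
    [min(i, m - 1 - j) = t], which are chains with 2 (m - 1 - t) + 1 elements;
    an antichain in the product of chains of lengths a and b has at most
    min(a, b) elements, and these minima add up to ceil(3 m^2 / 4). *)
Require Import Defs.
From mathcomp Require Import all_boot all_order all_algebra zify lra.

Import Order.TTheory GRing.Theory Num.Theory.

(** * Arithmetic of the bound *)

(** The product [m./2 * uphalf m] equals m^2/4 for even m and falls short of it by 1/4 for odd m. *)
Lemma three_quarters_sqE (m : nat) :
  ceil_three_quarters_sq m = (m ^ 2 - m./2 * uphalf m)%:Z%R.
Proof.
rewrite /ceil_three_quarters_sq.
have le_m : m./2 * uphalf m <= m ^ 2 by apply: leq_mul; lia.
apply: Num.Theory.ceil_def; rewrite -!pmulrn natrB // intrB -pmulrn.
rewrite natrB // natrM natrX uphalf_half natrD.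
have -> : (m%:R : rat)%R = ((odd m)%:R + 2%:R * (m./2)%:R)%R.
  by rewrite -[in LHS](odd_double_half m) natrD -mul2n natrM.
by case: (odd m) => /=; apply/andP; split; lra.
Qed.

Lemma sum_odd (n : nat) : \sum_(t < n) t.*2.+1 = n ^ 2.
Proof.
by elim: n => [|n IHn]; rewrite ?big_ord0 // big_ord_recr /= IHn; nia.
Qed.

(** The odd number is the smaller one precisely for t < u = [uphalf m]; with v = [m./2] the sum is
    u^2 + v m, and m = u + v turns it into m^2 - u v. *)
Lemma sum_minn_odd (m : nat) :
  \sum_(t < m) minn t.*2.+1 m = m ^ 2 - m./2 * uphalf m.
Proof.
have /(congr1 (fun n => \sum_(t < n) minn t.*2.+1 m)) -> :
  m = uphalf m + m./2 by lia.
rewrite big_split_ord /= (eq_bigr (fun t : 'I__ => t.*2.+1)); last first.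
  by move=> t _; have := ltn_ord t; lia.
rewrite sum_odd (eq_bigr (fun=> m)); last by move=> t _ /=; lia.
have eq_m : m = uphalf m + m./2 by lia.
rewrite sum_nat_const card_ord.
by move: (uphalf m) m./2 eq_m => u v ->; nia.
Qed.

Lemma sum_between (m a b : nat) : \sum_(j < m) (a <= j < b) = minn m b - a.
Proof.
by elim: m => [|m IHm]; rewrite ?big_ord0 ?big_ord_recr /= ?IHm; lia.
Qed.

(** The closed form is doubled and rearranged to avoid division and truncated subtraction. *)
Lemma sum_addn_ord (n a : nat) :
  (\sum_(i < n) (a + i)).*2 + n = n * (a.*2 + n).
Proof.
elim: n => [|n IHn]; rewrite ?big_ord0 // big_ord_recr /=.
by move: (bigop _ _ _) IHn => S; nia.
Qed.

Lemma sum_subn_ord (n a : nat) : n <= a.+1 ->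
  (\sum_(i < n) (a - i)).*2 + n ^ 2 = n * (a.*2.+1).
Proof.
elim: n => [|n IHn] le_n; rewrite ?big_ord0 // big_ord_recr /=.
by move: (bigop _ _ _) (IHn (ltnW le_n)) => S; nia.
Qed.

(** * Upper bound for oblique sets *)

(** The rank counts strict predecessors. It lets [lia] handle arbitrary orders on the index set. *)
Lemma total_order_rank (T : finType) (le : rel T) : total_order le ->
  exists2 r : T -> nat, forall x, r x < #|T| & forall x y, r x <= r y -> le x y.
Proof.
case=> asym_le tr_le tot_le.
exists (fun x => #|[set y | le y x & y != x]|) => [x|x y].
  rewrite -cardsT; apply: proper_card; apply/properP; split=> //.
  by exists x; rewrite ?inE // eqxx andbF.
(* If y is strictly below x, the predecessors of y are among those of x, and y itself makes the
   inclusion proper. *)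
apply: contraLR => nle_xy; rewrite -ltnNge; apply: proper_card.
have le_yx : le y x by have := tot_le x y; rewrite (negbTE nle_xy).
have neq_yx : y != x.
  by apply: contraNneq nle_xy => ->; have := tot_le x x; rewrite orbb.
apply/properP; split; last first.
  by exists y; rewrite inE ?le_yx ?neq_yx // eqxx andbF.
apply/subsetP=> z; rewrite !inE => /andP[le_zy neq_zy].
rewrite (tr_le _ _ _ le_zy le_yx) /=.
apply: contraNneq neq_zy => eq_zx; rewrite eq_zx in le_zy *.
by apply/eqP/asym_le; rewrite le_zy.
Qed.

Lemma leq_card_ord_inj (T : finType) (A : {set T}) (n : nat) (f : T -> nat) :
  {in A, forall x, f x < n} -> {in A &, injective f} -> #|A| <= n.
Proof.
move=> f_lt inj_f; case: n f_lt => [|n] f_lt.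
  by rewrite leqn0 cards_eq0; apply/set0Pn => -[x /f_lt].
rewrite -[n.+1]card_ord -(card_in_imset (f := fun x => inord (f x) : 'I_n.+1)).
  exact: max_card.
move=> x y xA yA /(congr1 val); rewrite /= !inordK ?f_lt //; exact: inj_f.
Qed.

Lemma oblique_card (m : nat) (S : {set triple m}) :
  is_oblique S -> #|S| <= m ^ 2 - m./2 * uphalf m.
Proof.
case=> _ [leA [leB [leC []]]].
move=> /total_order_rank[a a_lt aP] /total_order_rank[b b_lt bP].
move=> /total_order_rank[c c_lt cP] antiS.
rewrite !card_ord in a_lt b_lt c_lt.
have eqS x y : x \in S -> y \in S ->
    a x.1.1 <= a y.1.1 -> b x.1.2 <= b y.1.2 -> c x.2 <= c y.2 -> x = y.
  move=> xS yS /aP lea /bP leb /cP lec; apply: contraTeq isT => neq_xy.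
  by have := antiS x y xS yS neq_xy; rewrite /product_le lea leb lec.
(* [m - 1 - t] for the hook index of the header *)
pose level (x : triple m) := m.-1 - minn (a x.1.1) (m.-1 - b x.1.2).
have level_lt x : level x < m.
  by rewrite /level; have := a_lt x.1.1; lia.
rewrite -sum_minn_odd -sum1_card.
rewrite (partition_big (fun x => Ordinal (level_lt x)) predT) //=.
apply: leq_sum => t _.
have tP x : x \in [set x in S | Ordinal (level_lt x) == t] ->
    x \in S /\ level x = t.
  by rewrite inE => /andP[xS /eqP <-].
rewrite (eq_bigl (mem [set x in S | Ordinal (level_lt x) == t])); last first.
  by move=> x; rewrite !inE.
rewrite sum1_card leq_min; apply/andP; split.
(* Position along the hook: with s = m - 1 - t, it runs from (s, 0) up to (s, t), then to (m - 1,
   t), so the rank sum grows from s to s + 2t. Equal positions force equal pairs, and comparing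
   third entries concludes. *)
- apply: (@leq_card_ord_inj _ _ _ (fun x => a x.1.1 + b x.1.2 - (m.-1 - t))).
    move=> x /tP[_]; rewrite /level => ht.
    have := a_lt x.1.1; have := b_lt x.1.2; lia.
  move=> x y /tP[xS] + /tP[yS]; rewrite /level => hx hy eq_xy.
  have [xa xb] := (a_lt x.1.1, b_lt x.1.2).
  have [ya yb] := (a_lt y.1.1, b_lt y.1.2).
  have [le_c|/ltnW le_c] := leqP (c x.2) (c y.2).
    by apply: eqS => //; lia.
  by apply/esym/eqS => //; lia.
(* Given equal third entries, the rank sums decide which pair is lower, because the hook is a
   chain. *)
- apply: (@leq_card_ord_inj _ _ _ (fun x => c x.2)) => [x _|].
    exact: c_lt.
  move=> x y /tP[xS] + /tP[yS]; rewrite /level => hx hy eq_xy.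
  have [xa xb] := (a_lt x.1.1, b_lt x.1.2).
  have [ya yb] := (a_lt y.1.1, b_lt y.1.2).
  have [le_s|/ltnW le_s] := leqP (a x.1.1 + b x.1.2) (a y.1.1 + b y.1.2).
    by apply: eqS => //; lia.
  by apply/esym/eqS => //; lia.
Qed.

(** * From tight to oblique *)

Lemma total_order_preim_int (T : Type) (f : T -> int) :
  injective f -> total_order (fun x y => (f x <= f y)%R).
Proof.
move=> inj_f; split=> [x y /le_anti /inj_f //|y x z|x y]; last exact: le_total.
exact: le_trans.
Qed.

Lemma tight_oblique (m : nat) (S : {set triple m}) : is_tight S -> is_oblique S.
Proof.
case=> concS [a [b [c [inj_a inj_b inj_c sum0]]]]; split=> //.
exists (fun x y => (a x <= a y)%R), (fun x y => (b x <= b y)%R).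
exists (fun x y => (c x <= c y)%R); split; try exact: total_order_preim_int.
(* Three inequalities between terms of two zero sums must all be equalities. *)
have le_eq x y : x \in S -> y \in S ->
    [&& (a x.1.1 <= a y.1.1)%R, (b x.1.2 <= b y.1.2)%R & (c x.2 <= c y.2)%R] ->
    x = y.
  case: x y => [[i j] k] [[i' j'] k'] /sum0 s /sum0 s' /and3P /= [lea leb lec].
  have -> : i = i' by apply: inj_a; lia.
  have -> : j = j' by apply: inj_b; lia.
  by have -> : k = k' by apply: inj_c; lia.
move=> x y xS yS; apply: contra_neqN => /orP[]; first exact: le_eq.
by move=> le_yx; apply/esym/le_eq.
Qed.

(** * The extremal tight set *)

Definition level_set (m s : nat) : {set triple m} :=
  [set x : triple m | x.1.1 + x.1.2 + x.2 == s].

Lemma level_set_tight (m s : nat) : m.-1 <= s <= m.-1.*2 ->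
  is_tight (level_set m s).
Proof.
(* Conciseness: j is taken as large as possible and k is the remainder, at most m - 1 by the upper
   bound on s. By symmetry this serves all three projections. *)
move=> s_bnd; have fill (i : 'I_m) : exists j k : 'I_m, i + j + k = s.
  have i_lt := ltn_ord i.
  have j_lt : minn m.-1 (s - i) < m by lia.
  have k_lt : s - i - minn m.-1 (s - i) < m by lia.
  by exists (Ordinal j_lt), (Ordinal k_lt) => /=; lia.
split; first split=> i.
- by have [j [k eq_s]] := fill i; exists (i, j, k); rewrite // inE; apply/eqP.
- have [j [k eq_s]] := fill i; exists (j, i, k); rewrite // inE /=; lia.
- have [j [k eq_s]] := fill i; exists (j, k, i); rewrite // inE /=; lia.
exists (fun i => Posz i), (fun j => Posz j).
exists (fun k => (Posz k - Posz s)%R); split.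
- by move=> i j [] /val_inj.
- by move=> i j [] /val_inj.
- by move=> i j /addIr [] /val_inj.
- by move=> i j k; rewrite inE /=; lia.
Qed.

Lemma middle_level_card (m : nat) : 0 < m ->
  #|level_set m (m.-1 + m.-1./2)| = m ^ 2 - m./2 * uphalf m.
Proof.
move=> m_gt0; set h := m.-1./2.
have -> : #|level_set m (m.-1 + h)| =
    \sum_(i < m) \sum_(j < m) \sum_(k < m) (i + j + k == m.-1 + h).
  rewrite pair_big pair_big /= -sum1_card big_mkcond /=.
  by apply: eq_bigr => x _; rewrite inE; case: eqP.
have row (i : 'I_m) : \sum_(j < m) \sum_(k < m) (i + j + k == m.-1 + h) =
    minn m (m + h - i) - (h - i).
  rewrite -sum_between; apply: eq_bigr => j _.
  have [ilt jlt] := (ltn_ord i, ltn_ord j).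
  have -> : (h - i <= j < m + h - i) = (i + j <= m.-1 + h < i + j + m) by lia.
  (* The upper end is not the successor of the lower one: truncation makes the interval empty,
     rather than {0}, when i + j exceeds the level. *)
  rewrite (eq_bigr (fun k : 'I_m =>
    nat_of_bool (m.-1 + h - (i + j) <= k < m + h - (i + j)))).
    by rewrite sum_between; lia.
  by move=> k _; lia.
rewrite (eq_bigr _ (fun i _ => row i)).
(* Row sizes increase up to m at i = h and decrease afterwards, so the sum is cut after h. *)
have /(congr1 (fun n => \sum_(i < n) (minn m (m + h - i) - (h - i)))) -> :
  m = h.+1 + (m - h.+1) by lia.
rewrite big_split_ord /=.
rewrite (eq_bigr (fun i : 'I_h.+1 => m - h + i)); last first.
  by move=> i _; have := ltn_ord i; lia.
rewrite [X in _ + X](eq_bigr (fun i : 'I_(m - h.+1) => m.-1 - i)); last first.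
  by move=> i _; have := ltn_ord i; lia.
have := sum_addn_ord h.+1 (m - h).
have := @sum_subn_ord (m - h.+1) m.-1 ltac:(lia).
have [-> -> ->] : [/\ m - h.+1 = m./2, m - h = m./2.+1 & uphalf m = h.+1].
  by split; lia.
have [eq_m ->] : m = h.+1 + m./2 /\ m.-1 = h + m./2 by lia.
have r_bnd : h <= m./2 <= h.+1 by lia.
rewrite [in m ^ 2]eq_m.
move: h m./2 r_bnd {row eq_m} => h' r r_bnd.
move: (bigop _ _ _) (bigop _ _ _) => Y X eY eX.
(* The cases are m odd and m even. *)
have [eq_r|eq_r] : r = h' \/ r = h'.+1 by lia.
  by rewrite eq_r in eY eX *; nia.
by rewrite eq_r in eY eX *; nia.
Qed.

(** * Free sets *)

Lemma free_card (m : nat) (S : {set triple m}) : is_free S -> #|S| <= m ^ 2.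
Proof.
(* The first two entries determine a triple of [S], since triples agreeing there differ in at most
   one entry. *)
case=> _ freeS; rewrite -(card_in_imset (f := fst)).
  by rewrite (leq_trans (max_card _)) // card_prod card_ord.
move=> x y xS yS eq_xy; apply: contraTeq isT => neq_xy.
have := freeS x y xS yS neq_xy.
by rewrite /differing_entries eq_xy !eqxx; case: (_ != _).
Qed.

Definition addition_table (n : nat) : {set triple n.+1} :=
  [set (p, (p.1 + p.2)%R) | p : 'I_n.+1 * 'I_n.+1].

(** In the cyclic group on ['I_n.+1], cancellation lets any two of i, j, i + j determine the
    third. *)
Lemma addition_table_free (n : nat) : is_free (addition_table n).
Proof.
split; first split=> i.
- by exists (i, 0%R, (i + 0)%R) => //; apply/imsetP; exists (i, 0%R).
- by exists (0%R, i, (0 + i)%R) => //; apply/imsetP; exists (0%R, i).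
- exists (i, 0%R, (i + 0)%R); last by rewrite /= addr0.
  by apply/imsetP; exists (i, 0%R).
move=> x y /imsetP[[i j] _ ->] /imsetP[[i' j'] _ ->].
rewrite /differing_entries /=; have [<-|ne_i] := eqVneq i i'.
  by rewrite (inj_eq (addrI i)); have [<-|] := eqVneq j j'; rewrite ?eqxx.
by have [<-|//] := eqVneq j j'; rewrite (inj_eq (addIr j)) ne_i.
Qed.

Lemma addition_table_card (n : nat) : #|addition_table n| = n.+1 ^ 2.
Proof. by rewrite card_imset ?card_prod ?card_ord // => p q []. Qed.

Theorem theorem1p10 (m : nat) (hm : 1 <= m) :
  [/\ (forall S : {set triple m}, is_tight S ->
         (#|S|%:Z <= ceil_three_quarters_sq m)%R) /\
      (exists S : {set triple m}, is_tight S /\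
         (#|S|%:Z = ceil_three_quarters_sq m)%R),
      (forall S : {set triple m}, is_oblique S ->
         (#|S|%:Z <= ceil_three_quarters_sq m)%R) /\
      (exists S : {set triple m}, is_oblique S /\
         (#|S|%:Z = ceil_three_quarters_sq m)%R)
    & (forall S : {set triple m}, is_free S -> #|S| <= m ^ 2) /\
      (exists S : {set triple m}, is_free S /\ #|S| = m ^ 2)].
Proof.
rewrite three_quarters_sqE.
have tightM : is_tight (level_set m (m.-1 + m.-1./2)).
  by apply: level_set_tight; lia.
have cardM := middle_level_card m hm.
split; split=> [S|].
- by move=> /tight_oblique/oblique_card; rewrite lez_nat.
- by exists (level_set m (m.-1 + m.-1./2)); rewrite cardM.
- by move=> /oblique_card; rewrite lez_nat.
- exists (level_set m (m.-1 + m.-1./2)); rewrite cardM; split=> //.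
  exact: tight_oblique.
- exact: free_card.
case: m hm {tightM cardM} => // n _; exists (addition_table n).
by split; [apply: addition_table_free | apply: addition_table_card].
Qed.
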